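(* Let $q$ be a prime power and let $C$ be a linear $[n,k,d]_{q^2}$ code with parity check matrix $H$ and generator matrix $G$. Then $\operatorname{rank}(HH^\dagger)$ and $\operatorname{rank}(GG^\dagger)$ are independent of the choice of $H$ and $G$, and $$\operatorname{rank}(HH^\dagger)=n-k-\dim(\mathrm{Hull}_h(C))=n-k-\dim(\mathrm{Hull}_h(C^{\perp h})),$$ $$\operatorname{rank}(GG^\dagger)=k-\dim(\mathrm{Hull}_h(C))=k-\dim(\mathrm{Hull}_h(C^{\perp h})).$$
   Context: An $[n,k,d]_{q^2}$ linear code is a $k$-dimensional subspace of $\mathbb{F}_{q^2}^n$ with minimum Hamming distance $d$. For $a\in\mathbb{F}_{q^2}$ put $\overline a=a^q$, applied entrywise to vectors and matrices; $A^\dagger$ is the transpose of $\overline A$. The Hermitian dual is $C^{\perp h}=\{v\in\mathbb{F}_{q^2}^n : \sum_i v_i\overline{w_i}=0\ \forall w\in C\}$ and the Hermitian hull is $\mathrm{Hull}_h(C)=C\cap C^{\perp h}$. A generator matrix of $C$ is a $k\times n$ matrix whose rows form a basis of $C$; a parity check matrix of $C$ is an $(n-k)\times n$ matrix whose rows form a basis of the Euclidean dual $C^{\perp}=\{v\in\mathbb{F}_{q^2}^n:\sum_i v_iw_i=0\ \forall w\in C\}$. *)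

(* Defs.v *)
From HB Require Import structures.
From mathcomp Require Import all_boot all_order all_algebra all_field.

Set Implicit Arguments.
Unset Strict Implicit.
Unset Printing Implicit Defensive.

Import Order.TTheory GRing.Theory Num.Theory.
Local Open Scope ring_scope.

Definition prime_power (q : nat) : Prop :=
  exists p m : nat, [/\ prime p, (0 < m)%N & q = (p ^ m)%N].

Definition conjmx (F : finFieldType) (q m n : nat) (A : 'M[F]_(m, n)) :
    'M[F]_(m, n) :=
  map_mx (fun a => a ^+ q) A.

Definition dagger (F : finFieldType) (q m n : nat) (A : 'M[F]_(m, n)) :
    'M[F]_(n, m) :=
  (conjmx q A)^T.

Definition hamming_dist (F : finFieldType) (n : nat) (u v : 'rV[F]_n) : nat :=
  #|[set i : 'I_n | u 0 i != v 0 i]|.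

(* All distances are at most n, so the default value n matters only for a code
   without two distinct words, i.e. the zero code. *)
Definition min_dist (F : finFieldType) (n : nat) (C : {vspace 'rV[F]_n}) : nat :=
  \big[minn/n]_(p : 'rV[F]_n * 'rV[F]_n
                | [&& p.1 \in C, p.2 \in C & p.1 != p.2])
     hamming_dist p.1 p.2.

Definition linear_code (F : finFieldType) (n k d : nat)
    (C : {vspace 'rV[F]_n}) : Prop :=
  \dim C = k /\ min_dist C = d.

(* The two duals are intersections of kernels of linear forms; [mem_edual] and
   [mem_hdual] below give the usual coordinate description. *)
Definition edual (F : finFieldType) (n : nat) (C : {vspace 'rV[F]_n}) :
    {vspace 'rV[F]_n} :=
  (\bigcap_(w : 'rV[F]_n | w \in C) lker (linfun (mulmxr w^T)))%VS.

Definition hdual (F : finFieldType) (q n : nat) (C : {vspace 'rV[F]_n}) :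
    {vspace 'rV[F]_n} :=
  (\bigcap_(w : 'rV[F]_n | w \in C) lker (linfun (mulmxr (dagger q w))))%VS.

Definition hull (F : finFieldType) (q n : nat) (C : {vspace 'rV[F]_n}) :
    {vspace 'rV[F]_n} :=
  (C :&: hdual q C)%VS.

Definition generator_matrix (F : finFieldType) (n k : nat)
    (C : {vspace 'rV[F]_n}) (G : 'M[F]_(k, n)) : Prop :=
  basis_of C [seq row i G | i : 'I_k].

Definition parity_check_matrix (F : finFieldType) (n k : nat)
    (C : {vspace 'rV[F]_n}) (H : 'M[F]_(n - k, n)) : Prop :=
  basis_of (edual C) [seq row i H | i : 'I_(n - k)].

Lemma mem_bigcapv (F : fieldType) (V : vectType F) (I : finType) (P : pred I)
    (U : I -> {vspace V}) (v : V) :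
  reflect (forall i, P i -> v \in U i) (v \in (\bigcap_(i | P i) U i)%VS).
Proof. by rewrite memvE; apply: subv_bigcapP. Qed.

Lemma mem_edual (F : finFieldType) (n : nat) (C : {vspace 'rV[F]_n})
    (v : 'rV[F]_n) :
  v \in edual C <-> forall w, w \in C -> \sum_(i < n) v 0 i * w 0 i = 0.
Proof.
have E (w : 'rV[F]_n) : (v \in lker (linfun (mulmxr w^T))) = (\sum_i v 0 i * w 0 i == 0).
  rewrite memv_ker lfunE /=; apply/eqP/eqP => [/matrixP/(_ 0 0) | h].
    by rewrite !mxE => h; rewrite -[RHS]h; apply: eq_bigr => i _; rewrite !mxE.
  apply/matrixP => i j; rewrite !ord1 !mxE -[RHS]h.
  by apply: eq_bigr => l _; rewrite !mxE.
by split=> [/mem_bigcapv h w /h | h]; [|apply/mem_bigcapv=> w /h];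
  rewrite E => /eqP.
Qed.

Lemma mem_hdual (F : finFieldType) (q n : nat) (C : {vspace 'rV[F]_n})
    (v : 'rV[F]_n) :
  v \in hdual q C <->
  forall w, w \in C -> \sum_(i < n) v 0 i * (w 0 i) ^+ q = 0.
Proof.
have E (w : 'rV[F]_n) : (v \in lker (linfun (mulmxr (dagger q w)))) =
           (\sum_i v 0 i * (w 0 i) ^+ q == 0).
  rewrite memv_ker lfunE /=; apply/eqP/eqP => [/matrixP/(_ 0 0) | h].
    by rewrite !mxE => h; rewrite -[RHS]h; apply: eq_bigr => i _; rewrite !mxE.
  apply/matrixP => i j; rewrite !ord1 !mxE -[RHS]h.
  by apply: eq_bigr => l _; rewrite !mxE.
by split=> [/mem_bigcapv h w /h | h]; [|apply/mem_bigcapv=> w /h];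
  rewrite E => /eqP.
Qed.

(* Main.v *)
Require Import Defs.
From HB Require Import structures.
From mathcomp Require Import all_boot all_order all_algebra all_field.

Set Implicit Arguments.
Unset Strict Implicit.
Unset Printing Implicit Defensive.

Import Order.TTheory GRing.Theory Num.Theory.
Local Open Scope ring_scope.

(* If the rows of A span D, then Hull_h(D) is the intersection of the row space
   of A with the left kernel of A^dagger, so rank-nullity for A^dagger on that
   row space gives rank(A A^dagger) + dim Hull_h(D) = dim D.  This settles G
   with D = C.  Conjugating the entries of H gives a matrix whose rows span
   C^{perp h}; it has the same rank(H H^dagger), and
   Hull_h(C^{perp h}) = Hull_h(C) because C^{perp h perp h} = C. *)

(** The cardinality forces characteristic [p], so with q = p^m the map a -> a^q is the m-fold
    iterate of the Frobenius. As a ring morphism, conjugation commutes with matrix products and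
    kernels and preserves ranks. *)
Lemma prime_power_rmorphism (q : nat) (F : finFieldType) :
    prime_power q -> #|F| = (q ^ 2)%N ->
  exists s : {rmorphism F -> F}, s =1 (fun a => a ^+ q).
Proof.
case=> p [m [p_pr _ ->]]; rewrite -expnM => cardF.
have pF : p \in [pchar F] by apply: card_finPcharP cardF p_pr.
elim: m {cardF} => [|m [s sE]]; first by exists idfun => a; rewrite expn0 expr1.
exists (pFrobenius_aut pF \o s) => a /=.
by rewrite pFrobenius_autE sE -exprM expnSr.
Qed.

Lemma exprqK (q : nat) (F : finFieldType) :
  #|F| = (q ^ 2)%N -> involutive (fun a : F => a ^+ q).
Proof. by move=> cardF a; rewrite -exprM mulnn -cardF expf_card. Qed.

(** Bridge from subspaces to matrix row spaces. The rows of [A] may be dependent, so the square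
    matrix [kermx] can represent a dual. *)
Definition represents (F : fieldType) (m n : nat) (U : {vspace 'rV[F]_n})
    (A : 'M[F]_(m, n)) : Prop :=
  forall v, (v \in U) = (v <= A)%MS.

Lemma mem_limg_mulmxr (F : fieldType) (m n : nat) (A : 'M[F]_(m, n)) :
  represents (limg (linfun (mulmxr A))) A.
Proof.
move=> v; apply/memv_imgP/submxP=> [[u _ ->] | [u ->]]; exists u;
  by rewrite ?memvf ?lfunE.
Qed.

(** [row_base A] has the same row space as [A] and independent rows, so multiplication by it is an
    injection with image [U]. *)
Lemma dim_represents (F : fieldType) (m n : nat) (U : {vspace 'rV[F]_n})
    (A : 'M[F]_(m, n)) :
  represents U A -> \dim U = \rank A.
Proof.
move=> UA; pose f := linfun (mulmxr (row_base A)) : 'Hom('rV_(\rank A), 'rV_n).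
have ->: U = limg f.
  by apply/vspaceP=> v; rewrite mem_limg_mulmxr UA eq_row_base.
rewrite limg_dim_eq ?dimvf /dim /= ?mul1n //.
apply/eqP; rewrite capfv; apply/lker0P=> u v.
by rewrite !lfunE /=; apply: row_free_inj; apply: row_base_free.
Qed.

Lemma basis_of_rows_represents (F : fieldType) (m n : nat)
    (U : {vspace 'rV[F]_n}) (A : 'M[F]_(m, n)) :
  basis_of U [seq row i A | i : 'I_m] -> represents U A.
Proof.
move=> /span_basis <- v; rewrite -mem_limg_mulmxr.
suff ->: (<<[seq row i A | i : 'I_m]>> = limg (linfun (mulmxr A)))%VS by [].
apply/eqP; rewrite eqEsubv; apply/andP; split.
  by apply/span_subvP=> _ /imageP[i _ ->]; rewrite mem_limg_mulmxr row_sub.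
apply/subvP=> w; rewrite mem_limg_mulmxr => /submxP[u ->].
rewrite mulmx_sum_row rpred_sum // => i _.
by rewrite rpredZ // memv_span // image_f.
Qed.

Lemma exists_represents (F : fieldType) (n : nat) (U : {vspace 'rV[F]_n}) :
  exists A : 'M[F]_(\dim U, n), represents U A.
Proof.
exists (\matrix_i (vbasis U)`_i); apply: basis_of_rows_represents.
suff ->: [seq row i (\matrix_i (vbasis U)`_i) | i : 'I_(\dim U)] = vbasis U.
  exact: vbasisP.
apply: (@eq_from_nth _ 0); rewrite size_image card_ord ?size_tuple // => i ltiU.
by rewrite (nth_map (Ordinal ltiU)) ?size_enum_ord // rowK nth_enum_ord.
Qed.

Lemma dot_mulmx_tr (F : fieldType) (n : nat) (v w : 'rV[F]_n) :
  (\sum_i v 0 i * w 0 i == 0) = (v *m w^T == 0).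
Proof.
rewrite [v *m _]mx11_scalar fmorph_eq0 mxE.
by under [in RHS]eq_bigr do rewrite mxE.
Qed.

Lemma dim_rV_le (F : fieldType) (n : nat) (C : {vspace 'rV[F]_n}) : (\dim C <= n)%N.
Proof. by rewrite (leq_trans (dimvS (subvf C))) // dimvf /dim /= mul1n. Qed.

Lemma edual_represents (F : finFieldType) (m n : nat) (C : {vspace 'rV[F]_n})
    (A : 'M[F]_(m, n)) :
  represents C A -> represents (edual C) (kermx A^T).
Proof.
move=> CA v; apply/idP/sub_kermxP => [/mem_edual vC | vA0].
  (* Transposing makes each row of [A] contribute one row of the product; each such row vanishes
     because the rows of [A] lie in [C]. *)
  apply: trmx_inj; rewrite trmx_mul trmxK trmx0; apply/row_matrixP=> i.
  rewrite row_mul row0; apply/trmx_inj; rewrite trmx_mul trmxK trmx0; apply/eqP.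
  by rewrite -dot_mulmx_tr vC // CA row_sub.
apply/mem_edual=> w; rewrite CA => /submxP[u ->]; apply/eqP.
by rewrite dot_mulmx_tr trmx_mul mulmxA vA0 mul0mx.
Qed.

Section Duals.
Variables (q : nat) (F : finFieldType) (s : {rmorphism F -> F}).
Hypothesis sE : s =1 (fun a => a ^+ q).
Hypothesis cardF : #|F| = (q ^ 2)%N.

Lemma daggerE m n (A : 'M[F]_(m, n)) : dagger q A = (map_mx s A)^T.
Proof. by apply/matrixP=> i j; rewrite !mxE sE. Qed.

Lemma mem_hdual_dagger n (C : {vspace 'rV[F]_n}) (v : 'rV[F]_n) :
  v \in hdual q C <-> forall w, w \in C -> v *m dagger q w = 0.
Proof.
have E (w : 'rV[F]_n) : (\sum_i v 0 i * w 0 i ^+ q == 0) = (v *m dagger q w == 0).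
  rewrite daggerE -dot_mulmx_tr.
  by under [in RHS]eq_bigr do rewrite [map_mx _ _ _ _]mxE sE.
split=> [/mem_hdual h w /h/eqP | h]; first by rewrite E => /eqP.
by apply/mem_hdual=> w /h/eqP; rewrite -E => /eqP.
Qed.

Lemma hdual_represents m n (C : {vspace 'rV[F]_n}) (A : 'M[F]_(m, n)) :
  represents C A -> represents (hdual q C) (kermx (dagger q A)).
Proof.
move=> CA v; apply/idP/sub_kermxP => [/mem_hdual_dagger vC | vA0].
  apply: trmx_inj; rewrite daggerE trmx_mul trmxK trmx0; apply/row_matrixP=> i.
  rewrite row_mul row0; apply/trmx_inj; rewrite trmx_mul trmxK trmx0.
  by rewrite -map_row -daggerE vC // CA row_sub.
apply/mem_hdual_dagger=> w; rewrite CA => /submxP[u ->].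
by rewrite daggerE map_mxM trmx_mul mulmxA -daggerE vA0 mul0mx.
Qed.

Lemma rank_dagger m n (A : 'M[F]_(m, n)) : \rank (dagger q A) = \rank A.
Proof. by rewrite daggerE mxrank_tr mxrank_map. Qed.

Lemma dim_hdual n (C : {vspace 'rV[F]_n}) : \dim (hdual q C) = (n - \dim C)%N.
Proof.
have [A CA] := exists_represents C.
rewrite (dim_represents (hdual_represents CA)) mxrank_ker rank_dagger.
by rewrite -(dim_represents CA).
Qed.

(** One inclusion and equal dimensions suffice; n - (n - dim C) = dim C relies on dim C <= n,
    subtraction being truncated. *)
Lemma hdualK n (C : {vspace 'rV[F]_n}) : hdual q (hdual q C) = C.
Proof.
apply/esym/eqP; rewrite eqEdim !dim_hdual subKn ?dim_rV_le // leqnn andbT.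
(* Conjugating the sum of w_i v_i^q gives the sum of v_i w_i^q, because a^(q^2) = a. *)
apply/subvP=> v vC; apply/mem_hdual=> w /mem_hdual/(_ v vC) /(congr1 s).
rewrite rmorph0 rmorph_sum /= => wv0; rewrite -[RHS]wv0; apply: eq_bigr => i _.
by rewrite rmorphM !sE exprqK // mulrC.
Qed.

Lemma hull_hdual n (C : {vspace 'rV[F]_n}) : hull q (hdual q C) = hull q C.
Proof. by rewrite /hull hdualK capvC. Qed.

Lemma rank_gram_hull m n (D : {vspace 'rV[F]_n}) (A : 'M[F]_(m, n)) :
  represents D A -> (\rank (A *m dagger q A) + \dim (hull q D) = \dim D)%N.
Proof.
move=> DA; rewrite (dim_represents DA) -[RHS](mxrank_mul_ker _ (dagger q A)).
(* What remains is that the hull is represented by the row space of [A] cut with the kernel of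
   [dagger q A]. *)
congr (_ + _)%N; apply: dim_represents => v.
by rewrite memv_cap sub_capmx DA (hdual_represents DA).
Qed.

(** The rows of [H] span the left kernel of A^T for any [A] representing [C]. Conjugation carries
    this kernel to that of [dagger q A], which is the Hermitian dual. *)
Lemma conj_edual_represents m n (C : {vspace 'rV[F]_n}) (H : 'M[F]_(m, n)) :
  represents (edual C) H -> represents (hdual q C) (map_mx s H).
Proof.
move=> CH v; have [A CA] := exists_represents C.
have HA : (H :=: kermx A^T)%MS.
  apply/eqmxP/andP; split; apply/row_subP=> i.
    by rewrite -(edual_represents CA) CH row_sub.
  by rewrite -CH (edual_represents CA) row_sub.
rewrite (hdual_represents CA) daggerE map_trmx -map_kermx.
by rewrite ((map_eqmx s _ _).2 HA).
Qed.

(** The left product is the entrywise conjugate of the right one, and a field morphism preserves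
    rank. *)
Lemma rank_conj_gram m n (H : 'M[F]_(m, n)) :
  \rank (map_mx s H *m dagger q (map_mx s H)) = \rank (H *m dagger q H).
Proof. by rewrite !daggerE [in LHS]map_trmx -map_mxM mxrank_map. Qed.

End Duals.

Theorem proposition3p3 (q : nat) (hq : prime_power q)
    (F : finFieldType) (hF : #|F| = (q ^ 2)%N)
    (n k d : nat) (C : {vspace 'rV[F]_n}) (hC : linear_code k d C) :
  [/\ forall H1 H2 : 'M[F]_(n - k, n),
        parity_check_matrix C H1 -> parity_check_matrix C H2 ->
        \rank (H1 *m dagger q H1) = \rank (H2 *m dagger q H2),
      forall G1 G2 : 'M[F]_(k, n),
        generator_matrix C G1 -> generator_matrix C G2 ->
        \rank (G1 *m dagger q G1) = \rank (G2 *m dagger q G2),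
      forall H : 'M[F]_(n - k, n), parity_check_matrix C H ->
        (\rank (H *m dagger q H))%:Z
          = n%:Z - k%:Z - (\dim (hull q C))%:Z /\
        (\rank (H *m dagger q H))%:Z
          = n%:Z - k%:Z - (\dim (hull q (hdual q C)))%:Z
    & forall G : 'M[F]_(k, n), generator_matrix C G ->
        (\rank (G *m dagger q G))%:Z
          = k%:Z - (\dim (hull q C))%:Z /\
        (\rank (G *m dagger q G))%:Z
          = k%:Z - (\dim (hull q (hdual q C)))%:Z].
Proof.
have [s sE] := prime_power_rmorphism hq hF.
have [dimC _] := hC.
have lekn : (k <= n)%N by rewrite -dimC dim_rV_le.
have rankG (G : 'M[F]_(k, n)) : generator_matrix C G ->
    (\rank (G *m dagger q G) + \dim (hull q C) = k)%N.
  by move=> /basis_of_rows_represents CG; rewrite (rank_gram_hull sE CG).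
have rankH (H : 'M[F]_(n - k, n)) : parity_check_matrix C H ->
    (\rank (H *m dagger q H) + \dim (hull q C) = n - k)%N.
  move=> /basis_of_rows_represents /(conj_edual_represents sE).
  move=> /(rank_gram_hull sE).
  by rewrite (rank_conj_gram sE) (hull_hdual sE hF) (dim_hdual sE) dimC.
rewrite (hull_hdual sE hF); split.
(* Independence of the choice: both ranks give n - k after adding the same hull dimension, which
   cancels. *)
- by move=> H1 H2 /rankH e1 /rankH e2; apply: (addIn (etrans e1 (esym e2))).
- by move=> G1 G2 /rankG e1 /rankG e2; apply: (addIn (etrans e1 (esym e2))).
(* [lekn] makes the truncated n - k agree with the integer difference. *)
- by move=> H /rankH e; rewrite subzn // -[X in X%:Z - _]e PoszD addrK.
- by move=> G /rankG e; rewrite -[X in X%:Z - _]e PoszD addrK.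
Qed.
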